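(* Let $F:\mathcal G\to\mathcal G'$ be a morphism of graphs, let $\mathcal F_mF:\mathcal F_b\mathcal G\to\mathcal F_m\mathcal G'$ be the free morphism on $F$ (with $I_m:\mathcal G'\to\mathcal F_m\mathcal G'$), let $\Gamma:\mathcal F_b\mathcal G\to\mathcal F_s\mathcal G$ be the strict morphism with $\Gamma I_b=I_s$, and let $\mathcal F_sF:\mathcal F_s\mathcal G\to\mathcal F_s\mathcal G'$ be the strict morphism with $(\mathcal F_sF)I_s=I'_sF$. Let $\Delta:\mathcal F_m\mathcal G'\to\mathcal F_s\mathcal G'$ be the unique strict morphism with $\Delta I_m=I'_s$ and $\Delta\circ\mathcal F_mF=\mathcal F_sF\circ\Gamma$ (given by the universal property of $\mathcal F_mF$). Then $\Delta$ is a biequivalence; in particular it is locally faithful.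
   Context: A graph consists of a set of nodes and sets $\mathcal G(A,B)$ of edges; graph morphisms map nodes and edges compatibly. A bigroupoid consists of a set of 0-cells, hom-groupoids (objects: 1-cells; arrows: 2-cells), composition functors $*$, identity 1-cells, inversion functors $(-)^*$ and natural isomorphisms $\mathbf a,\mathbf l,\mathbf r,\mathbf e:f^**f\Rightarrow1,\mathbf i:1\Rightarrow f*f^*$ satisfying the pentagon, the triangle $(\mathrm{id}*\mathbf l)\circ\mathbf a=\mathbf r*\mathrm{id}$, and $\mathbf r_f\circ(\mathrm{id}*\mathbf e_f)\circ\mathbf a\circ(\mathbf i_f*\mathrm{id})=\mathbf l_f$. A morphism $(F,\phi)$ has a function on 0-cells, functors on hom-groupoids and natural isomorphisms $\phi_{g,f}:Fg*Ff\Rightarrow F(g*f)$, $\phi_A:1\Rightarrow F1_A$, $\phi_f:(Ff)^*\Rightarrow F(f^* )$ satisfying the standard coherence axioms ($F\mathbf a\circ\phi\circ(\phi*\mathrm{id})=\phi\circ(\mathrm{id}*\phi)\circ\mathbf a$, $F\mathbf r\circ\phi\circ(\mathrm{id}*\phi_A)=\mathbf r$, $F\mathbf l\circ\phi\circ(\phi_B*\mathrm{id})=\mathbf l$, $F\mathbf e\circ\phi\circ(\phi_f*\mathrm{id})=\phi_A\circ\mathbf e$, $F\mathbf i\circ\phi_B=\phi\circ(\mathrm{id}*\phi_f)\circ\mathbf i$); strict if $\phi$ is the identity. A 2-groupoid is a bigroupoid with $\mathbf a,\mathbf l,\mathbf r,\mathbf e,\mathbf i$ identities. The free bigroupoid $(\mathcal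 F_b\mathcal G,I_b)$ (resp. free 2-groupoid $(\mathcal F_s\mathcal G,I_s)$) on a graph is characterized by: every graph morphism from $\mathcal G$ to (the underlying graph of) a bigroupoid (resp. 2-groupoid) extends uniquely along $I_b$ (resp. $I_s$) to a strict morphism. The free morphism $\mathcal F_mF:\mathcal F_b\mathcal G\to\mathcal F_m\mathcal G'$ on a graph morphism $F:\mathcal G\to\mathcal G'$ comes with a graph morphism $I_m:\mathcal G'\to\mathcal F_m\mathcal G'$ with $(\mathcal F_mF)I_b=I_mF$, such that for every bigroupoid morphism $G:\mathcal A\to\mathcal B$ and graph morphisms $R:\mathcal G\to\mathcal A$, $S:\mathcal G'\to\mathcal B$ with $GR=SF$, there are unique strict morphisms $\widetilde R:\mathcal F_b\mathcal G\to\mathcal A$, $\widetilde S:\mathcal F_m\mathcal G'\to\mathcal B$ with $\widetilde RI_b=R$, $\widetilde SI_m=S$ and $G\widetilde R=\widetilde S\circ\mathcal F_mF$. A biequivalence is a morphism $F:\mathcal A\to\mathcal B$ such that every 0-cell of $\mathcal B$ admits a 1-cell into $FA'$ for some $A'$ and every hom-functor $F_{A,A'}$ is an equivalence of categories. *)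

(* Defs.v *)
Record graph := Graph {
  gob : Type;
  gedge : gob -> gob -> Type }.

Record gmorph (G H : graph) := GMorph {
  gmob : gob G -> gob H;
  gmedge : forall A B, gedge G A B -> gedge H (gmob A) (gmob B) }.
Arguments gmob {G H} _ _.
Arguments gmedge {G H} _ {A B} _.

Definition gcomp {G H K : graph} (N : gmorph H K) (M : gmorph G H) : gmorph G K :=
  GMorph G K (fun A => gmob N (gmob M A)) (fun A B e => gmedge N (gmedge M e)).

Record bigroupoid := Bigroupoid {
  ob : Type;
  hom : ob -> ob -> Type;
  cell : forall {A B : ob}, hom A B -> hom A B -> Type;
  vcomp : forall {A B} {f g h : hom A B}, cell g h -> cell f g -> cell f h;
  id2 : forall {A B} (f : hom A B), cell f f;
  inv2 : forall {A B} {f g : hom A B}, cell f g -> cell g f;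
  vcompA : forall A B (f g h k : hom A B) (x : cell h k) (y : cell g h) (z : cell f g),
      vcomp x (vcomp y z) = vcomp (vcomp x y) z;
  vcomp1l : forall A B (f g : hom A B) (x : cell f g), vcomp (id2 g) x = x;
  vcomp1r : forall A B (f g : hom A B) (x : cell f g), vcomp x (id2 f) = x;
  inv2l : forall A B (f g : hom A B) (x : cell f g), vcomp (inv2 x) x = id2 f;
  inv2r : forall A B (f g : hom A B) (x : cell f g), vcomp x (inv2 x) = id2 g;
  hcomp : forall {A B C}, hom B C -> hom A B -> hom A C;
  hcomp2 : forall {A B C} {g g' : hom B C} {f f' : hom A B},
      cell g g' -> cell f f' -> cell (hcomp g f) (hcomp g' f');
  hcomp2_id : forall A B C (g : hom B C) (f : hom A B),
      hcomp2 (id2 g) (id2 f) = id2 (hcomp g f);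
  hcomp2_comp : forall A B C (g g' g'' : hom B C) (f f' f'' : hom A B)
      (b' : cell g' g'') (b : cell g g') (a' : cell f' f'') (a : cell f f'),
      hcomp2 (vcomp b' b) (vcomp a' a) = vcomp (hcomp2 b' a') (hcomp2 b a);
  id1 : forall A, hom A A;
  rev : forall {A B}, hom A B -> hom B A;
  rev2 : forall {A B} {f g : hom A B}, cell f g -> cell (rev f) (rev g);
  rev2_id : forall A B (f : hom A B), rev2 (id2 f) = id2 (rev f);
  rev2_comp : forall A B (f g h : hom A B) (y : cell g h) (x : cell f g),
      rev2 (vcomp y x) = vcomp (rev2 y) (rev2 x);
  assoc : forall {A B C D} (h : hom C D) (g : hom B C) (f : hom A B),
      cell (hcomp (hcomp h g) f) (hcomp h (hcomp g f));
  assoc_nat : forall A B C D (h h' : hom C D) (g g' : hom B C) (f f' : hom A B)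
      (c : cell h h') (b : cell g g') (a : cell f f'),
      vcomp (assoc h' g' f') (hcomp2 (hcomp2 c b) a)
      = vcomp (hcomp2 c (hcomp2 b a)) (assoc h g f);
  lunit : forall {A B} (f : hom A B), cell (hcomp (id1 B) f) f;
  lunit_nat : forall A B (f f' : hom A B) (a : cell f f'),
      vcomp (lunit f') (hcomp2 (id2 (id1 B)) a) = vcomp a (lunit f);
  runit : forall {A B} (f : hom A B), cell (hcomp f (id1 A)) f;
  runit_nat : forall A B (f f' : hom A B) (a : cell f f'),
      vcomp (runit f') (hcomp2 a (id2 (id1 A))) = vcomp a (runit f);
  ev : forall {A B} (f : hom A B), cell (hcomp (rev f) f) (id1 A);
  ev_nat : forall A B (f g : hom A B) (a : cell f g),
      vcomp (ev g) (hcomp2 (rev2 a) a) = vcomp (id2 (id1 A)) (ev f);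
  coev : forall {A B} (f : hom A B), cell (id1 B) (hcomp f (rev f));
  coev_nat : forall A B (f g : hom A B) (a : cell f g),
      vcomp (hcomp2 a (rev2 a)) (coev f) = vcomp (coev g) (id2 (id1 B));
  pentagon : forall A B C D E (k : hom D E) (h : hom C D) (g : hom B C) (f : hom A B),
      vcomp (assoc k h (hcomp g f)) (assoc (hcomp k h) g f)
      = vcomp (hcomp2 (id2 k) (assoc h g f))
          (vcomp (assoc k (hcomp h g) f) (hcomp2 (assoc k h g) (id2 f)));
  triangle : forall A B C (g : hom B C) (f : hom A B),
      vcomp (hcomp2 (id2 g) (lunit f)) (assoc g (id1 B) f)
      = hcomp2 (runit g) (id2 f);
  ev_coev : forall A B (f : hom A B),
      vcomp (runit f) (vcomp (hcomp2 (id2 f) (ev f))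
        (vcomp (assoc f (rev f) f) (hcomp2 (coev f) (id2 f))))
      = lunit f
}.

Arguments hom {b0} _ _.
Arguments cell {b0 A B} _ _.
Arguments vcomp {b0 A B f g h} _ _.
Arguments id2 {b0 A B} _.
Arguments inv2 {b0 A B f g} _.
Arguments hcomp {b0 A B C} _ _.
Arguments hcomp2 {b0 A B C g g' f f'} _ _.
Arguments id1 {b0} _.
Arguments rev {b0 A B} _.
Arguments rev2 {b0 A B f g} _.
Arguments assoc {b0 A B C D} _ _ _.
Arguments lunit {b0 A B} _.
Arguments runit {b0 A B} _.
Arguments ev {b0 A B} _.
Arguments coev {b0 A B} _.

Definition cell_of_eq {X : bigroupoid} {A B : ob X} {f g : hom A B} (e : f = g) : cell f g :=
  match e in _ = g' return cell f g' with eq_refl => id2 f end.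

Definition is_2groupoid (X : bigroupoid) : Prop :=
  (forall (A B C D : ob X) (h : hom C D) (g : hom B C) (f : hom A B),
      exists e, assoc h g f = cell_of_eq e) /\
  (forall (A B : ob X) (f : hom A B), exists e, lunit f = cell_of_eq e) /\
  (forall (A B : ob X) (f : hom A B), exists e, runit f = cell_of_eq e) /\
  (forall (A B : ob X) (f : hom A B), exists e, ev f = cell_of_eq e) /\
  (forall (A B : ob X) (f : hom A B), exists e, coev f = cell_of_eq e).

Definition bgraph (X : bigroupoid) : graph := Graph (ob X) (@hom X).

Record mdata (X Y : bigroupoid) := MData {
  mob : ob X -> ob Y;
  mhom : forall {A A' : ob X}, hom A A' -> hom (mob A) (mob A');
  mcell : forall {A A' : ob X} {f g : hom A A'}, cell f g -> cell (mhom f) (mhom g);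
  mphi2 : forall {A1 A2 A3 : ob X} (g : hom A2 A3) (f : hom A1 A2),
      cell (hcomp (mhom g) (mhom f)) (mhom (hcomp g f));
  mphi0 : forall A : ob X, cell (id1 (mob A)) (mhom (id1 A));
  mphiv : forall {A A' : ob X} (f : hom A A'), cell (rev (mhom f)) (mhom (rev f)) }.
Arguments mob {X Y} _ _.
Arguments mhom {X Y} _ {A A'} _.
Arguments mcell {X Y} _ {A A' f g} _.
Arguments mphi2 {X Y} _ {A1 A2 A3} _ _.
Arguments mphi0 {X Y} _ _.
Arguments mphiv {X Y} _ {A A'} _.

Definition is_morphism {X Y : bigroupoid} (F : mdata X Y) : Prop :=
  (forall (A A' : ob X) (f : hom A A'), mcell F (id2 f) = id2 (mhom F f)) /\
  (forall (A A' : ob X) (f g h : hom A A') (y : cell g h) (x : cell f g),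
      mcell F (vcomp y x) = vcomp (mcell F y) (mcell F x)) /\
  (forall (A1 A2 A3 : ob X) (g g' : hom A2 A3) (f f' : hom A1 A2)
      (b : cell g g') (a : cell f f'),
      vcomp (mcell F (hcomp2 b a)) (mphi2 F g f)
      = vcomp (mphi2 F g' f') (hcomp2 (mcell F b) (mcell F a))) /\
  (forall (A A' : ob X) (f g : hom A A') (a : cell f g),
      vcomp (mcell F (rev2 a)) (mphiv F f) = vcomp (mphiv F g) (rev2 (mcell F a))) /\
  (forall (A B C D : ob X) (h : hom C D) (g : hom B C) (f : hom A B),
      vcomp (mcell F (assoc h g f))
        (vcomp (mphi2 F (hcomp h g) f) (hcomp2 (mphi2 F h g) (id2 (mhom F f))))
      = vcomp (mphi2 F h (hcomp g f))
          (vcomp (hcomp2 (id2 (mhom F h)) (mphi2 F g f))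
                 (assoc (mhom F h) (mhom F g) (mhom F f)))) /\
  (forall (A B : ob X) (f : hom A B),
      vcomp (mcell F (runit f)) (vcomp (mphi2 F f (id1 A)) (hcomp2 (id2 (mhom F f)) (mphi0 F A)))
      = runit (mhom F f)) /\
  (forall (A B : ob X) (f : hom A B),
      vcomp (mcell F (lunit f)) (vcomp (mphi2 F (id1 B) f) (hcomp2 (mphi0 F B) (id2 (mhom F f))))
      = lunit (mhom F f)) /\
  (forall (A B : ob X) (f : hom A B),
      vcomp (mcell F (ev f)) (vcomp (mphi2 F (rev f) f) (hcomp2 (mphiv F f) (id2 (mhom F f))))
      = vcomp (mphi0 F A) (ev (mhom F f))) /\
  (forall (A B : ob X) (f : hom A B),
      vcomp (mcell F (coev f)) (mphi0 F B)
      = vcomp (mphi2 F f (rev f))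
          (vcomp (hcomp2 (id2 (mhom F f)) (mphiv F f)) (coev (mhom F f)))).

Record morphism (X Y : bigroupoid) := Morphism {
  mdat :> mdata X Y;
  mdat_ok : is_morphism mdat }.
Arguments mdat {X Y} _.

Definition is_strict {X Y : bigroupoid} (F : mdata X Y) : Prop :=
  (forall (A1 A2 A3 : ob X) (g : hom A2 A3) (f : hom A1 A2),
      exists e, mphi2 F g f = cell_of_eq e) /\
  (forall A : ob X, exists e, mphi0 F A = cell_of_eq e) /\
  (forall (A A' : ob X) (f : hom A A'), exists e, mphiv F f = cell_of_eq e).

Definition mcomp {X Y Z : bigroupoid} (N : mdata Y Z) (M : mdata X Y) : mdata X Z :=
  MData X Z
    (fun A => mob N (mob M A))
    (fun A A' f => mhom N (mhom M f))
    (fun A A' f g a => mcell N (mcell M a))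
    (fun A1 A2 A3 g f => vcomp (mcell N (mphi2 M g f)) (mphi2 N (mhom M g) (mhom M f)))
    (fun A => vcomp (mcell N (mphi0 M A)) (mphi0 N (mob M A)))
    (fun A A' f => vcomp (mcell N (mphiv M f)) (mphiv N (mhom M f))).

Definition mgraph {X Y : bigroupoid} (F : mdata X Y) : gmorph (bgraph X) (bgraph Y) :=
  GMorph (bgraph X) (bgraph Y) (mob F) (fun A B f => mhom F f).

Definition is_free_bigroupoid (G : graph) (X : bigroupoid) (I : gmorph G (bgraph X)) : Prop :=
  forall (Y : bigroupoid) (R : gmorph G (bgraph Y)),
    (exists M : morphism X Y, is_strict M /\ gcomp (mgraph M) I = R) /\
    (forall M N : morphism X Y, is_strict M -> is_strict N ->
       gcomp (mgraph M) I = R -> gcomp (mgraph N) I = R -> mdat M = mdat N).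

Definition is_free_2groupoid (G : graph) (X : bigroupoid) (I : gmorph G (bgraph X)) : Prop :=
  is_2groupoid X /\
  forall (Y : bigroupoid), is_2groupoid Y -> forall (R : gmorph G (bgraph Y)),
    (exists M : morphism X Y, is_strict M /\ gcomp (mgraph M) I = R) /\
    (forall M N : morphism X Y, is_strict M -> is_strict N ->
       gcomp (mgraph M) I = R -> gcomp (mgraph N) I = R -> mdat M = mdat N).

(* (Y, FmF, Im) is the free morphism on F : G -> G', where (X, Ib) is the free
   bigroupoid on G *)
Definition is_free_morphism {G G' : graph} (F : gmorph G G')
    (X : bigroupoid) (Ib : gmorph G (bgraph X))
    (Y : bigroupoid) (FmF : morphism X Y) (Im : gmorph G' (bgraph Y)) : Prop :=
  gcomp (mgraph FmF) Ib = gcomp Im F /\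
  forall (A B : bigroupoid) (Gm : morphism A B)
         (R : gmorph G (bgraph A)) (S : gmorph G' (bgraph B)),
    gcomp (mgraph Gm) R = gcomp S F ->
    (exists (Rt : morphism X A) (St : morphism Y B),
        is_strict Rt /\ is_strict St /\ gcomp (mgraph Rt) Ib = R /\
        gcomp (mgraph St) Im = S /\ mcomp Gm Rt = mcomp St FmF) /\
    (forall (Rt Rt' : morphism X A) (St St' : morphism Y B),
        is_strict Rt -> is_strict St -> gcomp (mgraph Rt) Ib = R ->
        gcomp (mgraph St) Im = S -> mcomp Gm Rt = mcomp St FmF ->
        is_strict Rt' -> is_strict St' -> gcomp (mgraph Rt') Ib = R ->
        gcomp (mgraph St') Im = S -> mcomp Gm Rt' = mcomp St' FmF ->
        mdat Rt = mdat Rt' /\ mdat St = mdat St').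

(* the hom-functor F_{A,A'} : X(A,A') -> Y(FA,FA') is an equivalence of
   categories: it has a pseudo-inverse functor K with natural isomorphisms
   eta : Id => K F and eps : F K => Id (every 2-cell is invertible, so
   natural transformations between these groupoid-valued functors are
   automatically natural isomorphisms). *)
Definition hom_equivalence {X Y : bigroupoid} (F : mdata X Y) (A A' : ob X) : Prop :=
  exists (K : hom (mob F A) (mob F A') -> hom A A')
         (Kc : forall g g' : hom (mob F A) (mob F A'), cell g g' -> cell (K g) (K g'))
         (eta : forall f : hom A A', cell f (K (mhom F f)))
         (eps : forall g : hom (mob F A) (mob F A'), cell (mhom F (K g)) g),
    (forall g, Kc g g (id2 g) = id2 (K g)) /\
    (forall g g' g'' (y : cell g' g'') (x : cell g g'),
        Kc g g'' (vcomp y x) = vcomp (Kc g' g'' y) (Kc g g' x)) /\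
    (forall (f f' : hom A A') (a : cell f f'),
        vcomp (Kc _ _ (mcell F a)) (eta f) = vcomp (eta f') a) /\
    (forall g g' (b : cell g g'),
        vcomp b (eps g) = vcomp (eps g') (mcell F (Kc g g' b))).

Definition is_biequivalence {X Y : bigroupoid} (F : mdata X Y) : Prop :=
  (forall B : ob Y, exists A' : ob X, inhabited (hom B (mob F A'))) /\
  (forall A A' : ob X, hom_equivalence F A A').

Definition locally_faithful {X Y : bigroupoid} (F : mdata X Y) : Prop :=
  forall (A A' : ob X) (f g : hom A A') (a b : cell f g), mcell F a = mcell F b -> a = b.

(* Main.v *)
(** A free 2-groupoid is locally discrete, so it suffices that parallel 2-cells of the free morphism
    [FmG'] coincide and that [Del] is, up to 2-cells, a bijection on 1-cells. For the latter,
    identify isomorphic 1-cells of [FmG']: by uniqueness, the quotient map factors through [Del] as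
    [K Del], and the map [Dbar] induced by [Del] on the quotient satisfies [Dbar K = id].

    For the former, choose representatives of the isomorphism classes of 1-cells out of a 0-cell
    [C], and call lifting of [f : A -> B] a choice of 2-cells [f ** u => v], for all representatives
    [u] and [v] for which there is one. Liftings can be composed, inverted and transported along
    2-cells, so they form a bigroupoid over [FmG'], and over [FbG] along [FmF]. The universal
    property of [FmF] provides a section, that is, a system of liftings preserved by every 2-cell.
    If [a : f => g], then [a ** u] is determined by the liftings of [f] and [g], hence so is [a]. No
    normal form for 1-cells is needed. *)

Require Import Defs.
From Corelib Require Import ssreflect.
From Stdlib Require Import FunctionalExtensionality PropExtensionality
  ProofIrrelevance ClassicalEpsilon.

Declare Scope bicat_scope.
Local Open Scope bicat_scope.
Local Infix "@" := vcomp (at level 40, left associativity) : bicat_scope.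
Local Infix "**" := hcomp (at level 35, right associativity) : bicat_scope.
Local Infix "##" := hcomp2 (at level 35, right associativity) : bicat_scope.

(** * Extensionality and the calculus of 2-cells *)

Lemma sig_eq {A : Type} {P : A -> Prop} (x y : {a : A | P a}) :
  proj1_sig x = proj1_sig y -> x = y.
Proof. by move: x y => [x p] [y q] /= e; apply: subset_eq_compat. Qed.

Lemma gmorph_eta {G H : graph} (M : gmorph G H) :
  GMorph G H (gmob M) (fun A B e => gmedge M e) = M.
Proof. by case: M. Qed.

Lemma gmorph_eq {G H : graph} (o : gob G -> gob H)
    (h h' : forall A B, gedge G A B -> gedge H (o A) (o B)) :
  (forall A B e, h A B e = h' A B e) -> GMorph G H o h = GMorph G H o h'.
Proof.
by move=> hh; f_equal; do 3!(apply: functional_extensionality_dep => ?); apply: hh.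
Qed.

Lemma vcomp_assoc {X : bigroupoid} {A B : ob X} {f g h k : hom A B}
    (x : cell h k) (y : cell g h) (z : cell f g) :
  x @ (y @ z) = x @ y @ z.
Proof. exact: vcompA. Qed.

Lemma vcompKl {X : bigroupoid} {A B : ob X} {f g h : hom A B} (x : cell g h) (y z : cell f g) :
  x @ y = x @ z -> y = z.
Proof.
move=> e; rewrite -(vcomp1l _ _ _ _ _ y) -(vcomp1l _ _ _ _ _ z) -(inv2l _ _ _ _ _ x).
by rewrite -!vcompA e.
Qed.

Lemma vcompKr {X : bigroupoid} {A B : ob X} {f g h : hom A B} (x : cell f g) (y z : cell g h) :
  y @ x = z @ x -> y = z.
Proof.
move=> e; rewrite -(vcomp1r _ _ _ _ _ y) -(vcomp1r _ _ _ _ _ z) -(inv2r _ _ _ _ _ x).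
by rewrite !vcompA e.
Qed.

Lemma inv2_comp {X : bigroupoid} {A B : ob X} {f g h : hom A B} (x : cell g h) (y : cell f g) :
  inv2 (x @ y) = inv2 y @ inv2 x.
Proof.
apply: (vcompKr (x @ y)); rewrite inv2l !vcompA -(vcomp_assoc (inv2 y)).
by rewrite inv2l vcomp1r inv2l.
Qed.

Lemma hcomp2_wl {X : bigroupoid} {A B C : ob X} (g : hom B C) {f f' f'' : hom A B}
    (x : cell f' f'') (y : cell f f') :
  id2 g ## (x @ y) = (id2 g ## x) @ (id2 g ## y).
Proof. by rewrite -hcomp2_comp vcomp1l. Qed.

Lemma hcomp2_wr {X : bigroupoid} {A B C : ob X} (f : hom A B) {g g' g'' : hom B C}
    (x : cell g' g'') (y : cell g g') :
  (x @ y) ## id2 f = (x ## id2 f) @ (y ## id2 f).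
Proof. by rewrite -hcomp2_comp vcomp1l. Qed.

Lemma hcomp2_lr {X : bigroupoid} {A B C : ob X} {g g' : hom B C} {f f' : hom A B}
    (x : cell g g') (y : cell f f') :
  (x ## id2 f') @ (id2 g ## y) = x ## y.
Proof. by rewrite -hcomp2_comp vcomp1l vcomp1r. Qed.

Lemma hcomp2_rl {X : bigroupoid} {A B C : ob X} {g g' : hom B C} {f f' : hom A B}
    (x : cell g g') (y : cell f f') :
  (id2 g' ## y) @ (x ## id2 f) = x ## y.
Proof. by rewrite -hcomp2_comp vcomp1l vcomp1r. Qed.

Lemma hcomp2_id1_inj {X : bigroupoid} {A B : ob X} {f g : hom A B} (a b : cell f g) :
  id2 (id1 B) ## a = id2 (id1 B) ## b -> a = b.
Proof. by move=> e; apply: (vcompKr (lunit f)); rewrite -!lunit_nat e. Qed.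

(** Whiskering once more with [rev u] gives whiskering with [u ** rev u]; naturality along [coev u]
    turns this into whiskering with [id1 A], which [runit] removes. *)
Lemma hcomp2_whisker_inj {X : bigroupoid} {A B C : ob X} (u : hom C A) {f g : hom A B}
    (a b : cell f g) :
  a ## id2 u = b ## id2 u -> a = b.
Proof.
move=> e.
have e1 : a ## id2 (u ** rev u) = b ## id2 (u ** rev u).
  rewrite -hcomp2_id; apply: (vcompKr (assoc f u (rev u))).
  by rewrite -!assoc_nat e.
have e2 : a ## id2 (id1 A) = b ## id2 (id1 A).
  apply: (vcompKl (id2 g ## coev u)).
  by rewrite !hcomp2_rl -(hcomp2_lr a (coev u)) -(hcomp2_lr b (coev u)) e1.
by apply: (vcompKr (runit f)); rewrite -!runit_nat e2.
Qed.

(* Kelly's redundancy of the left unit axiom: whisker with the unit on the left. *)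
Lemma lunit_hcomp {X : bigroupoid} {A B C : ob X} (f : hom B C) (u : hom A B) :
  lunit (f ** u) @ assoc (id1 C) f u = lunit f ## id2 u.
Proof.
apply: hcomp2_id1_inj; rewrite hcomp2_wl.
(* Precomposition with this invertible 2-cell completes one side of the pentagon for [id1 C],
   [id1 C], [f], [u]. *)
apply: (vcompKr (assoc (id1 C) (id1 C ** f) u @ (assoc (id1 C) (id1 C) f ## id2 u))).
rewrite -vcompA -pentagon vcompA triangle -hcomp2_id -assoc_nat -triangle hcomp2_wr.
by rewrite !vcompA assoc_nat.
Qed.

(* The zigzag identity [ev_coev], with a 1-cell [v] composed on the right. *)
Lemma zigzag_hcomp {X : bigroupoid} {A B C : ob X} (f : hom B C) (v : hom A B) :
  (id2 f ## lunit v) @ ((id2 f ## (ev f ## id2 v)) @ ((id2 f ## inv2 (assoc (rev f) f v)) @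
    (assoc f (rev f) (f ** v) @ (coev f ## id2 (f ** v)))))
  = lunit (f ** v).
Proof.
(* By [lunit_hcomp] the right side becomes [lunit f ## id2 v], into which the axiom [ev_coev] can be
   substituted. *)
apply: (vcompKr (assoc (id1 C) f v)); rewrite lunit_hcomp -(ev_coev X _ _ f) !hcomp2_wr.
rewrite -hcomp2_id -!vcompA -assoc_nat (vcomp_assoc (assoc f _ _)) pentagon.
rewrite -!vcompA (vcomp_assoc (id2 f ## inv2 _)) -hcomp2_wl inv2l hcomp2_id vcomp1l.
rewrite (vcomp_assoc (id2 f ## (ev f ## id2 v))) -assoc_nat.
by rewrite !vcompA triangle.
Qed.

(** * Equality 2-cells and locally discrete bigroupoids *)

Definition is_eqcell {X : bigroupoid} {A B : ob X} {f g : hom A B} (a : cell f g) : Prop :=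
  exists e : f = g, a = cell_of_eq e.

Definition locally_discrete (X : bigroupoid) : Prop :=
  forall (A B : ob X) (f g : hom A B) (a : cell f g), is_eqcell a.

(** Equalities between two given 1-cells coincide by proof irrelevance, so coherence equations
    between equality 2-cells are automatic. *)
Lemma is_eqcell_unique {X : bigroupoid} {A B : ob X} {f g : hom A B} (a b : cell f g) :
  is_eqcell a -> is_eqcell b -> a = b.
Proof. by move=> [e ->] [e' ->]; rewrite (proof_irrelevance _ e e'). Qed.

Lemma is_eqcell_id2 {X : bigroupoid} {A B : ob X} (f : hom A B) : is_eqcell (id2 f).
Proof. by exists eq_refl. Qed.

Lemma is_eqcell_vcomp {X : bigroupoid} {A B : ob X} {f g h : hom A B}
    (x : cell g h) (y : cell f g) :
  is_eqcell x -> is_eqcell y -> is_eqcell (x @ y).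
Proof. by move=> [e ->] [e' ->]; destruct e, e'; exists eq_refl; rewrite /= vcomp1l. Qed.

Lemma is_eqcell_hcomp2 {X : bigroupoid} {A B C : ob X} {g g' : hom B C} {f f' : hom A B}
    (x : cell g g') (y : cell f f') :
  is_eqcell x -> is_eqcell y -> is_eqcell (x ## y).
Proof. by move=> [e ->] [e' ->]; destruct e, e'; exists eq_refl; rewrite /= hcomp2_id. Qed.

Lemma is_eqcell_rev2 {X : bigroupoid} {A B : ob X} {f g : hom A B} (x : cell f g) :
  is_eqcell x -> is_eqcell (rev2 x).
Proof. by move=> [e ->]; destruct e; exists eq_refl; rewrite /= rev2_id. Qed.

Lemma is_eqcell_cell_of_eq {X : bigroupoid} {A B : ob X} {f g : hom A B} (e : f = g) :
  is_eqcell (cell_of_eq e).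
Proof. by exists e. Qed.

Create HintDb eqcell.
Hint Resolve is_eqcell_id2 is_eqcell_vcomp is_eqcell_hcomp2 is_eqcell_rev2
  is_eqcell_cell_of_eq : eqcell.

Lemma is_2groupoid_eqcells (X : bigroupoid) :
  is_2groupoid X <->
  (forall (A B C D : ob X) (h : hom C D) (g : hom B C) (f : hom A B), is_eqcell (assoc h g f)) /\
  (forall (A B : ob X) (f : hom A B), is_eqcell (lunit f)) /\
  (forall (A B : ob X) (f : hom A B), is_eqcell (runit f)) /\
  (forall (A B : ob X) (f : hom A B), is_eqcell (ev f)) /\
  (forall (A B : ob X) (f : hom A B), is_eqcell (coev f)).
Proof. by []. Qed.

Lemma locally_discrete_is_2groupoid (X : bigroupoid) : locally_discrete X -> is_2groupoid X.
Proof. by move=> dX; apply/is_2groupoid_eqcells; do 4?[split] => *; apply: dX. Qed.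

Lemma locally_discrete_unique (X : bigroupoid) :
  locally_discrete X -> forall (A B : ob X) (f g : hom A B) (a b : cell f g), a = b.
Proof. by move=> dX *; apply: is_eqcell_unique; apply: dX. Qed.

Lemma morphism_to_locally_discrete {X Y : bigroupoid} (F : mdata X Y) :
  locally_discrete Y -> is_morphism F.
Proof. by move=> dY; do 8?[split] => *; apply: locally_discrete_unique. Qed.

Lemma strict_to_locally_discrete {X Y : bigroupoid} (F : mdata X Y) :
  locally_discrete Y -> is_strict F.
Proof. by move=> dY; do 2?[split] => *; apply: dY. Qed.

(** * Identity and composition of morphisms *)

Lemma mdata_eq {X Y : bigroupoid} (o : ob X -> ob Y)
    (h : forall A A', hom A A' -> hom (o A) (o A'))
    (c : forall A A' (f g : hom A A'), cell f g -> cell (h A A' f) (h A A' g))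
    phi2 phi2' phi0 phi0' phiv phiv' :
  (forall A1 A2 A3 (g : hom A2 A3) (f : hom A1 A2), phi2 A1 A2 A3 g f = phi2' A1 A2 A3 g f) ->
  (forall A, phi0 A = phi0' A) ->
  (forall A A' (f : hom A A'), phiv A A' f = phiv' A A' f) ->
  MData X Y o h c phi2 phi0 phiv = MData X Y o h c phi2' phi0' phiv'.
Proof.
move=> e2 e0 ev.
have -> : phi2 = phi2'.
  by do 5!(apply: functional_extensionality_dep => ?); apply: e2.
have -> : phi0 = phi0' by apply: functional_extensionality_dep.
have -> // : phiv = phiv'.
by do 3!(apply: functional_extensionality_dep => ?); apply: ev.
Qed.

Definition mid (X : bigroupoid) : mdata X X :=
  MData X X (fun A => A) (fun A A' f => f) (fun A A' f g a => a)
    (fun A1 A2 A3 g f => id2 (hcomp g f)) (fun A => id2 (id1 A)) (fun A A' f => id2 (rev f)).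

Lemma mid_ok (X : bigroupoid) : is_morphism (mid X).
Proof. by do 8?[split] => * //=; rewrite !(hcomp2_id, vcomp1r, vcomp1l). Qed.

Lemma mid_strict (X : bigroupoid) : is_strict (mid X).
Proof. by do 2?[split] => *; exists eq_refl. Qed.

Definition mor_id (X : bigroupoid) : morphism X X := Morphism X X (mid X) (mid_ok X).

(** Each coherence axiom combines the image under [N] of the axiom for [M] with the axiom for [N];
    naturality of [mphi2 N] brings the 2-cells into the order that this requires. *)
Lemma mcomp_ok {X Y Z : bigroupoid} (N : morphism Y Z) (M : morphism X Y) :
  is_morphism (mcomp N M).
Proof.
case: N => N [N1 [Nc [N2 [Nr [Na [Nru [Nlu [Ne Nco]]]]]]]].
case: M => M [M1 [Mc [M2 [Mr [Ma [Mru [Mlu [Me Mco]]]]]]]] /=.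
split; [|split; [|split; [|split; [|split; [|split; [|split; [|split]]]]]]] => /=.
- by move=> *; rewrite M1 N1.
- by move=> *; rewrite Mc Nc.
- move=> A1 A2 A3 g g' f f' b a.
  by rewrite vcompA -Nc M2 Nc -vcompA N2 vcompA.
- move=> A A' f g a.
  by rewrite vcompA -Nc Mr Nc -vcompA Nr vcompA.
- move=> A B C D h g f.
  have := f_equal (mcell N) (Ma A B C D h g f); rewrite !Nc => e.
  rewrite hcomp2_wl hcomp2_wr -!N1 -!vcompA.
  rewrite (vcomp_assoc (mphi2 N _ _) (_ ## _) (_ ## _)) -N2 -!vcompA.
  rewrite (vcomp_assoc (mcell N (mphi2 M _ _)) (mcell N (_ ## _))).
  rewrite (vcomp_assoc (mcell N (mcell M _))) e -!vcompA N1 Na.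
  by rewrite (vcomp_assoc (mcell N (_ ## _))) N2 N1 -!vcompA.
- move=> A B f.
  rewrite hcomp2_wl -!N1 -!vcompA (vcomp_assoc (mphi2 N _ _)) -N2.
  by rewrite -[RHS]Nru -Mru !Nc !N1 -!vcompA.
- move=> A B f.
  rewrite hcomp2_wr -!N1 -!vcompA (vcomp_assoc (mphi2 N _ _)) -N2.
  by rewrite -[RHS]Nlu -Mlu !Nc !N1 -!vcompA.
- move=> A B f.
  have := f_equal (mcell N) (Me A B f); rewrite !Nc => e.
  rewrite hcomp2_wr -!N1 -!vcompA (vcomp_assoc (mphi2 N _ _)) -N2.
  by rewrite N1 -!vcompA -Ne (vcomp_assoc (mcell N (mphi0 M _))) -e -!vcompA.
- move=> A B f.
  have := f_equal (mcell N) (Mco A B f); rewrite !Nc => e.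
  rewrite hcomp2_wl -!N1 -!vcompA (vcomp_assoc (mphi2 N _ _)) -N2 N1 -!vcompA -Nco.
  by rewrite vcompA e -!vcompA.
Qed.

Definition mor_comp {X Y Z : bigroupoid} (N : morphism Y Z) (M : morphism X Y) : morphism X Z :=
  Morphism X Z (mcomp N M) (mcomp_ok N M).

Lemma mcell_id2 {X Y : bigroupoid} (F : morphism X Y) (A B : ob X) (f : hom A B) :
  mcell F (id2 f) = id2 (mhom F f).
Proof. by case: F => F [F1 ?]; apply: F1. Qed.

Lemma mcell_vcomp {X Y : bigroupoid} (F : morphism X Y) (A B : ob X) (f g h : hom A B)
    (x : cell g h) (y : cell f g) :
  mcell F (x @ y) = mcell F x @ mcell F y.
Proof. by case: F => F [F1 [Fc ?]]; apply: Fc. Qed.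

Lemma mcell_eqcell {X Y : bigroupoid} (F : morphism X Y) (A B : ob X) (f g : hom A B)
    (x : cell f g) :
  is_eqcell x -> is_eqcell (mcell F x).
Proof. by move=> [e ->]; destruct e; exists eq_refl; rewrite /= mcell_id2. Qed.

Lemma mcomp_strict {X Y Z : bigroupoid} (N : morphism Y Z) (M : morphism X Y) :
  is_strict N -> is_strict M -> is_strict (mcomp N M).
Proof.
move=> [N2 [N0 Nv]] [M2 [M0 Mv]]; split; [|split] => *; apply: is_eqcell_vcomp;
  by [apply: mcell_eqcell; (apply: M2 || apply: M0 || apply: Mv)
     | apply: N2 | apply: N0 | apply: Nv].
Qed.

Lemma mcompA {W X Y Z : bigroupoid} (L : morphism Y Z) (M : mdata X Y) (N : mdata W X) :
  mcomp L (mcomp M N) = mcomp (mcomp L M) N.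
Proof. by apply: mdata_eq => *; rewrite mcell_vcomp vcompA. Qed.

Lemma mcomp1r {X Y : bigroupoid} (F : morphism X Y) : mcomp F (mid X) = F.
Proof.
case: F => F oF; rewrite -[RHS]/F; move: (mcell_id2 (Morphism _ _ F oF)) => /=.
by case: F oF => o h c p2 p0 pv oF /= F1; apply: mdata_eq => * /=; rewrite F1 vcomp1l.
Qed.

Lemma mcomp1l {X Y : bigroupoid} (F : mdata X Y) : mcomp (mid Y) F = F.
Proof. by case: F => *; apply: mdata_eq => * /=; rewrite vcomp1r. Qed.

(** * Local discreteness of free 2-groupoids *)

(* A groupoid, seen as a bigroupoid whose 2-cells are the equalities of 1-cells. *)
Definition discrete_bigroupoid (O : Type) (H : O -> O -> Type)
    (comp : forall A B C, H B C -> H A B -> H A C) (one : forall A, H A A)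
    (inv : forall A B, H A B -> H B A)
    (compA : forall A B C D (h : H C D) (g : H B C) (f : H A B),
       comp _ _ _ (comp _ _ _ h g) f = comp _ _ _ h (comp _ _ _ g f))
    (comp1l : forall A B (f : H A B), comp _ _ _ (one B) f = f)
    (comp1r : forall A B (f : H A B), comp _ _ _ f (one A) = f)
    (compVl : forall A B (f : H A B), comp _ _ _ (inv _ _ f) f = one A)
    (compVr : forall A B (f : H A B), one B = comp _ _ _ f (inv _ _ f)) : bigroupoid.
Proof.
refine (Bigroupoid O H (fun A B f g => f = g) (fun A B f g h x y => eq_trans y x)
  (fun A B f => eq_refl) (fun A B f g x => eq_sym x) _ _ _ _ _
  comp (fun A B C g g' f f' b a => f_equal2 (comp A B C) b a) _ _ one
  inv (fun A B f g a => f_equal (inv A B) a) _ _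
  compA _ comp1l _ comp1r _ compVl _ compVr _ _ _ _);
  (* Each remaining goal equates two proofs of the same equality of 1-cells. *)
  by cbv beta; intros; apply: proof_irrelevance.
Defined.

Lemma discrete_locally_discrete O H comp one inv compA comp1l comp1r compVl compVr :
  locally_discrete (discrete_bigroupoid O H comp one inv compA comp1l comp1r compVl compVr).
Proof. by move=> A B f g a; exists a; exact: (proof_irrelevance (f = g)). Qed.

Lemma eqcell_eq {X : bigroupoid} {A B : ob X} {f g : hom A B} (a : cell f g) :
  is_eqcell a -> f = g.
Proof. by case. Qed.


(* The 1-cells of a 2-groupoid form a groupoid [D], which includes strictly into it; freeness
   splits the inclusion, so that every 2-cell comes from an equality. *)
Lemma free_2groupoid_locally_discrete (G : graph) (X : bigroupoid) (I : gmorph G (bgraph X)) :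
  is_free_2groupoid G X I -> locally_discrete X.
Proof.
move=> [sX uX].
case: (proj1 (is_2groupoid_eqcells X) sX) => aX [lX [rX [eX iX]]].
pose D := discrete_bigroupoid (ob X) (@hom X) (@hcomp X) (@id1 X) (@rev X)
    (fun A B C D h g f => eqcell_eq _ (aX A B C D h g f)) (fun A B f => eqcell_eq _ (lX A B f))
    (fun A B f => eqcell_eq _ (rX A B f)) (fun A B f => eqcell_eq _ (eX A B f))
    (fun A B f => eqcell_eq _ (iX A B f)).
have dD : locally_discrete D by apply: discrete_locally_discrete.
pose j := MData D X (fun A => A) (fun A A' f => f) (fun A A' f g e => cell_of_eq e)
  (fun A1 A2 A3 g f => @id2 X _ _ (@hcomp X _ _ _ g f))
  (fun A => @id2 X _ _ (@id1 X A)) (fun A A' f => @id2 X _ _ (@rev X _ _ f)).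
have j_ok : is_morphism j.
  by do 8?[split] => * /=; apply: is_eqcell_unique; auto 8 with eqcell.
pose J := Morphism D X j j_ok.
have sJ : is_strict J by do 2?[split] => *; exists eq_refl.
case: (uX D (locally_discrete_is_2groupoid _ dD) I) => [[M [sM MI]] _].
have JM : mdat (mor_comp J M) = mid X.
  by apply: (proj2 (uX X sX I) (mor_comp J M) (mor_id X) (mcomp_strict _ _ sJ sM)
    (mid_strict X) MI (gmorph_eta I)).
(* For [mor_comp J M] this holds by the definition of [j]. Rewriting with [JM] then replaces
   0-cells, 1-cells and 2-cells at once, which avoids any transport. *)
have : forall (A B : ob X) (f g : hom A B) (a : cell f g), is_eqcell (mcell (mor_comp J M) a).
  by move=> *; apply: is_eqcell_cell_of_eq.
by rewrite JM.
Qed.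

(** * Isomorphism classes of 1-cells and the locally discrete quotient *)

Definition iso1 {X : bigroupoid} {A B : ob X} (f g : hom A B) : Prop := inhabited (cell f g).

Lemma iso1_refl {X : bigroupoid} {A B : ob X} (f : hom A B) : iso1 f f.
Proof. by split; apply: id2. Qed.

Lemma iso1_sym {X : bigroupoid} {A B : ob X} (f g : hom A B) : iso1 f g -> iso1 g f.
Proof. by move=> [x]; split; apply: inv2. Qed.

Lemma iso1_trans {X : bigroupoid} {A B : ob X} (f g h : hom A B) :
  iso1 f g -> iso1 g h -> iso1 f h.
Proof. by move=> [x] [y]; split; apply: (y @ x). Qed.

Lemma iso1_hcomp {X : bigroupoid} {A B C : ob X} (g g' : hom B C) (f f' : hom A B) :
  iso1 g g' -> iso1 f f' -> iso1 (g ** f) (g' ** f').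
Proof. by move=> [x] [y]; split; apply: (x ## y). Qed.

Lemma iso1_rev {X : bigroupoid} {A B : ob X} (f g : hom A B) :
  iso1 f g -> iso1 (rev f) (rev g).
Proof. by move=> [x]; split; apply: rev2. Qed.

Definition nf {X : bigroupoid} {A B : ob X} (f : hom A B) : hom A B :=
  epsilon (inhabits f) (iso1 f).

Lemma nf_iso {X : bigroupoid} {A B : ob X} (f : hom A B) : iso1 f (nf f).
Proof. by apply: (epsilon_spec (inhabits f) (iso1 f)); exists f; apply: iso1_refl. Qed.

Lemma iso_nf {X : bigroupoid} {A B : ob X} (f : hom A B) : iso1 (nf f) f.
Proof. by apply/iso1_sym/nf_iso. Qed.

(** The predicates [iso1 f] and [iso1 g] are equal by extensionality, so [epsilon] makes the same
    choice for both. *)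
Lemma nf_eq {X : bigroupoid} {A B : ob X} (f g : hom A B) : iso1 f g -> nf f = nf g.
Proof.
move=> fg; rewrite /nf (proof_irrelevance _ (inhabits f) (inhabits g)); f_equal.
apply: functional_extensionality => h; apply: propositional_extensionality.
by split; apply: iso1_trans => //; apply: iso1_sym.
Qed.

Lemma nf_nf {X : bigroupoid} {A B : ob X} (f : hom A B) : nf (nf f) = nf f.
Proof. by apply/nf_eq/iso_nf. Qed.

(** A class is encoded by its chosen representative, that is, by a fixed point of [nf]. *)
Definition class1 {X : bigroupoid} (A B : ob X) : Type := {f : hom A B | nf f = f}.

Definition cls {X : bigroupoid} {A B : ob X} (f : hom A B) : class1 A B :=
  exist _ (nf f) (nf_nf f).

Lemma cls_eq {X : bigroupoid} {A B : ob X} (f g : hom A B) : iso1 f g -> cls f = cls g.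
Proof. by move=> fg; apply/sig_eq/nf_eq. Qed.

Lemma cls_iso {X : bigroupoid} {A B : ob X} (f g : hom A B) : cls f = cls g -> iso1 f g.
Proof.
move=> [fg]; apply: (iso1_trans _ _ _ (nf_iso f)); rewrite fg; exact: iso_nf.
Qed.

Lemma cls_repr {X : bigroupoid} {A B : ob X} (x : class1 A B) : cls (proj1_sig x) = x.
Proof. by apply: sig_eq; apply: (proj2_sig x). Qed.

(** The operations are computed on representatives; the structural 2-cells of [X] become equalities
    of classes and give the groupoid laws. *)
Definition quotient1 (X : bigroupoid) : bigroupoid.
Proof.
refine (discrete_bigroupoid (ob X) (@class1 X)
  (fun A B C g f => cls (proj1_sig g ** proj1_sig f)) (fun A => cls (id1 A))
  (fun A B f => cls (rev (proj1_sig f))) _ _ _ _ _) => /=.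
- move=> A B C D h g f; apply: cls_eq.
  apply: (iso1_trans _ ((proj1_sig h ** proj1_sig g) ** proj1_sig f)).
    by apply: iso1_hcomp (iso_nf _) (iso1_refl _).
  apply: (iso1_trans _ (proj1_sig h ** proj1_sig g ** proj1_sig f)).
    by split; apply: assoc.
  by apply: iso1_hcomp (iso1_refl _) (nf_iso _).
- move=> A B f; rewrite -[RHS]cls_repr; apply: cls_eq.
  apply: iso1_trans (iso1_hcomp _ _ _ _ (iso_nf _) (iso1_refl _)) _.
  by split; apply: lunit.
- move=> A B f; rewrite -[RHS]cls_repr; apply: cls_eq.
  apply: iso1_trans (iso1_hcomp _ _ _ _ (iso1_refl _) (iso_nf _)) _.
  by split; apply: runit.
- move=> A B f; apply: cls_eq.
  apply: iso1_trans (iso1_hcomp _ _ _ _ (iso_nf _) (iso1_refl _)) _.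
  by split; apply: ev.
- move=> A B f; apply: cls_eq.
  apply: iso1_trans (iso1_hcomp _ _ _ _ (iso1_refl _) (nf_iso _)).
  by split; apply: coev.
Defined.

Lemma quotient1_discrete (X : bigroupoid) : locally_discrete (quotient1 X).
Proof. exact: discrete_locally_discrete. Qed.

Definition quotient_mor (X : bigroupoid) : morphism X (quotient1 X).
Proof.
refine (Morphism X (quotient1 X)
  (MData X (quotient1 X) (fun A => A) (fun A B f => cls f)
     (fun A B f g a => cls_eq f g (inhabits a)) _ _ _)
  (morphism_to_locally_discrete _ (quotient1_discrete X))).
- move=> A B C g f; apply: cls_eq; apply: iso1_hcomp; exact: iso_nf.
- by [].
- move=> A B f; apply: cls_eq; apply: iso1_rev; exact: iso_nf.
Defined.

Lemma mhom_iso1 {X Y : bigroupoid} (dY : locally_discrete Y) (F : mdata X Y) (A B : ob X)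
    (f g : hom A B) :
  iso1 f g -> mhom F f = mhom F g.
Proof. by case=> a; apply: eqcell_eq (dY _ _ _ _ (mcell F a)). Qed.

(* A morphism from [X] to a locally discrete bigroupoid factors through [quotient1 X]. *)
Definition quotient_lift {X Y : bigroupoid} (dY : locally_discrete Y) (F : morphism X Y) :
  morphism (quotient1 X) Y :=
  Morphism (quotient1 X) Y
    (MData (quotient1 X) Y (mob F) (fun A B f => mhom F (proj1_sig f))
      (fun A B f g a => cell_of_eq (f_equal (fun h => mhom F (proj1_sig h)) a))
      (fun A B C g f => cell_of_eq
         (eq_trans (eqcell_eq _ (dY _ _ _ _ (mphi2 F (proj1_sig g) (proj1_sig f))))
            (mhom_iso1 dY F _ _ _ _ (nf_iso _))))
      (fun A => cell_of_eq
         (eq_trans (eqcell_eq _ (dY _ _ _ _ (mphi0 F A))) (mhom_iso1 dY F _ _ _ _ (nf_iso _))))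
      (fun A B f => cell_of_eq
         (eq_trans (eqcell_eq _ (dY _ _ _ _ (mphiv F (proj1_sig f))))
            (mhom_iso1 dY F _ _ _ _ (nf_iso _)))))
    (morphism_to_locally_discrete _ dY).

(** * Comparison of the free 2-groupoid with the quotient *)

(* A 2-groupoid free on [G] is a retract of [quotient1 Y] as soon as its generators lift to [Y]. *)
Lemma free_2groupoid_section {G : graph} {S Y : bigroupoid} (I : gmorph G (bgraph S))
    (J : gmorph G (bgraph Y)) (D : morphism Y S) (freeS : is_free_2groupoid G S I)
    (dS : locally_discrete S) :
  gcomp (mgraph D) J = I ->
  exists K : morphism S (quotient1 Y),
    gcomp (mgraph K) I = gcomp (mgraph (quotient_mor Y)) J /\
    mcomp (quotient_lift dS D) K = mid S.
Proof.
move=> DJ; case: freeS => sS uS; have dQ := quotient1_discrete Y.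
case: (uS _ (locally_discrete_is_2groupoid _ dQ) (gcomp (mgraph (quotient_mor Y)) J)).
move=> [K [sK KI]] _; exists K; split=> //.
apply: (proj2 (uS S sS I) (mor_comp (quotient_lift dS D) K) (mor_id S)
  (strict_to_locally_discrete _ dS) (mid_strict S) _ (gmorph_eta I)).
rewrite -[LHS]/(gcomp (mgraph (quotient_lift dS D)) (gcomp (mgraph K) I)) KI -[RHS]DJ.
(* On a generator, the lift evaluates [D] at the representative of [J x]; this has the same image as
   [J x] itself, since [S] is locally discrete. *)
apply: gmorph_eq => A B x /=; exact: mhom_iso1 (iso_nf _).
Qed.

Definition transport_hom {X : bigroupoid} {A A' B B' : ob X} (e : A = B) (e' : A' = B')
    (f : hom A A') : hom B B' :=
  match e in _ = b, e' in _ = b' return hom b b' with eq_refl, eq_refl => f end.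


(** A preimage of [g] is the representative of [mhom K g], where [K] is the section. Its end points
    are mapped to [B] and [B'] only up to propositional equality, hence the transport. *)
Lemma free_2groupoid_full {G : graph} {S Y : bigroupoid} (I : gmorph G (bgraph S))
    (J : gmorph G (bgraph Y)) (D : morphism Y S) (freeS : is_free_2groupoid G S I) :
  gcomp (mgraph D) J = I ->
  forall (B B' : ob S) (g : hom B B'),
    exists (A A' : ob Y) (f : hom A A') (e : mob D A = B) (e' : mob D A' = B'),
      transport_hom e e' (mhom D f) = g.
Proof.
move=> DJ; have dS := free_2groupoid_locally_discrete _ _ _ freeS.
case: (free_2groupoid_section I J D freeS dS DJ) => K [_ DK].
(* For the composite with [K] both equalities are [eq_refl]; rewriting with [DK] gives the general
   claim. *)
have : forall (B B' : ob S) (g : hom B B'),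
    exists (A A' : ob Y) (f : hom A A') (e : mob D A = mob (mcomp (quotient_lift dS D) K) B)
      (e' : mob D A' = mob (mcomp (quotient_lift dS D) K) B'),
      transport_hom e e' (mhom D f) = mhom (mcomp (quotient_lift dS D) K) g.
  by move=> B B' g; exists _, _, (proj1_sig (mhom K g)), eq_refl, eq_refl.
by rewrite DK.
Qed.

(** The universal property of [FmF] is applied to [mor_comp K FsF], with [Is] and the classes of
    [Im] on generators. The pairs of [Gam] with [mcomp K Del] and of [Gam] with the quotient map are
    both solutions, hence equal. *)
Lemma free_morphism_quotient {G G' : graph} {F : gmorph G G'}
    {FbG : bigroupoid} {Ib : gmorph G (bgraph FbG)} (Hb : is_free_bigroupoid G FbG Ib)
    {FsG : bigroupoid} {Is : gmorph G (bgraph FsG)}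
    {FsG' : bigroupoid} {Is' : gmorph G' (bgraph FsG')}
    {FmG' : bigroupoid} {FmF : morphism FbG FmG'} {Im : gmorph G' (bgraph FmG')}
    (Hm : is_free_morphism F FbG Ib FmG' FmF Im)
    {Gam : morphism FbG FsG} (HGam_s : is_strict Gam) (HGam : gcomp (mgraph Gam) Ib = Is)
    {FsF : morphism FsG FsG'} (HFsF : gcomp (mgraph FsF) Is = gcomp Is' F)
    {Del : morphism FmG' FsG'} (HDel1 : gcomp (mgraph Del) Im = Is')
    (HDel2 : mcomp Del FmF = mcomp FsF Gam)
    (K : morphism FsG' (quotient1 FmG')) :
  gcomp (mgraph K) Is' = gcomp (mgraph (quotient_mor FmG')) Im ->
  mcomp K Del = quotient_mor FmG'.
Proof.
move=> KI; set q := quotient_mor FmG' in KI *; have dQ := quotient1_discrete FmG'.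
have sQ (X : bigroupoid) (M : mdata X (quotient1 FmG')) : is_strict M.
  exact: strict_to_locally_discrete.
case: Hm => FmI uM.
have KF : gcomp (mgraph (mor_comp K FsF)) Is = gcomp (gcomp (mgraph q) Im) F.
  by rewrite -[LHS]/(gcomp (mgraph K) (gcomp (mgraph FsF) Is)) HFsF -KI.
(* Both sides are strict morphisms out of the free bigroupoid, so agreement on the generators
   suffices. *)
have sq : mcomp (mcomp K FsF) Gam = mcomp q FmF.
  apply: (proj2 (Hb _ (gcomp (gcomp (mgraph q) Im) F)) (mor_comp (mor_comp K FsF) Gam)
    (mor_comp q FmF) (sQ _ _) (sQ _ _)).
    by rewrite -[LHS]/(gcomp (mgraph (mor_comp K FsF)) (gcomp (mgraph Gam) Ib)) HGam.
  by rewrite -[LHS]/(gcomp (mgraph q) (gcomp (mgraph FmF) Ib)) FmI.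
apply: (proj2 (proj2 (uM _ _ (mor_comp K FsF) Is (gcomp (mgraph q) Im) KF) Gam Gam
   (mor_comp K Del) q HGam_s (sQ _ _) HGam _ _ HGam_s (sQ _ _) HGam eq_refl sq)).
- by rewrite -[LHS]/(gcomp (mgraph K) (gcomp (mgraph Del) Im)) HDel1.
- by rewrite /= -!mcompA HDel2.
Qed.

(** * Displayed bigroupoids and their total bigroupoids *)

(* A bigroupoid displayed over [Y] on the same 0-cells, whose projection is a discrete fibration
   on 2-cells: each 1-cell [f] carries a set [fam f] of structures, transported along 2-cells. *)
Record displayed (Y : bigroupoid) := Displayed {
  fam : forall {A B : ob Y}, hom A B -> Type;
  act : forall {A B : ob Y} {f g : hom A B}, cell f g -> fam f -> fam g;
  dcomp : forall {A B C : ob Y} {g : hom B C} {f : hom A B}, fam g -> fam f -> fam (g ** f);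
  did1 : forall A : ob Y, fam (id1 A);
  drev : forall {A B : ob Y} {f : hom A B}, fam f -> fam (rev f);
  act_id : forall A B (f : hom A B) (x : fam f), act (id2 f) x = x;
  act_comp : forall A B (f g h : hom A B) (b : cell g h) (a : cell f g) (x : fam f),
      act (b @ a) x = act b (act a x);
  dcomp_nat : forall A B C (g g' : hom B C) (f f' : hom A B) (b : cell g g') (a : cell f f')
      (y : fam g) (x : fam f), dcomp (act b y) (act a x) = act (b ## a) (dcomp y x);
  drev_nat : forall A B (f g : hom A B) (a : cell f g) (x : fam f),
      drev (act a x) = act (rev2 a) (drev x);
  dassoc : forall A B C D (h : hom C D) (g : hom B C) (f : hom A B)
      (z : fam h) (y : fam g) (x : fam f),
      act (assoc h g f) (dcomp (dcomp z y) x) = dcomp z (dcomp y x);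
  dlunit : forall A B (f : hom A B) (x : fam f), act (lunit f) (dcomp (did1 B) x) = x;
  drunit : forall A B (f : hom A B) (x : fam f), act (runit f) (dcomp x (did1 A)) = x;
  dev : forall A B (f : hom A B) (x : fam f), act (ev f) (dcomp (drev x) x) = did1 A;
  dcoev : forall A B (f : hom A B) (x : fam f), act (coev f) (did1 B) = dcomp x (drev x) }.
Arguments fam {Y} _ {A B} _.
Arguments act {Y} _ {A B f g} _ _.
Arguments dcomp {Y} _ {A B C g f} _ _.
Arguments did1 {Y} _ _.
Arguments drev {Y} _ {A B f} _.
Arguments act_id {Y} _ {A B f} _.
Arguments act_comp {Y} _ {A B f g h} _ _ _.
Arguments dcomp_nat {Y} _ {A B C g g' f f'} _ _ _ _.
Arguments drev_nat {Y} _ {A B f g} _ _.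
Arguments dassoc {Y} _ {A B C D h g f} _ _ _.
Arguments dlunit {Y} _ {A B f} _.
Arguments drunit {Y} _ {A B f} _.
Arguments dev {Y} _ {A B f} _.
Arguments dcoev {Y} _ {A B f} _.

Definition tot_hom {Z Y : bigroupoid} (H : morphism Z Y) (D : displayed Y) (A B : ob Z) : Type :=
  {f : hom A B & fam D (mhom H f)}.

Definition over {Z Y : bigroupoid} {H : morphism Z Y} {D : displayed Y} {A B : ob Z}
    (f g : tot_hom H D A B) (a : cell (projT1 f) (projT1 g)) : Prop :=
  act D (mcell H a) (projT2 f) = projT2 g.

Definition tot_cell {Z Y : bigroupoid} (H : morphism Z Y) (D : displayed Y) {A B : ob Z}
    (f g : tot_hom H D A B) : Type :=
  {a : cell (projT1 f) (projT1 g) | over f g a}.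

Definition tot_comp {Z Y : bigroupoid} {H : morphism Z Y} {D : displayed Y} {A B C : ob Z}
    (g : tot_hom H D B C) (f : tot_hom H D A B) : tot_hom H D A C :=
  existT _ (projT1 g ** projT1 f)
    (act D (mphi2 H (projT1 g) (projT1 f)) (dcomp D (projT2 g) (projT2 f))).

Definition tot_id {Z Y : bigroupoid} {H : morphism Z Y} {D : displayed Y} (A : ob Z) :
    tot_hom H D A A :=
  existT _ (id1 A) (act D (mphi0 H A) (did1 D (mob H A))).

Definition tot_rev {Z Y : bigroupoid} {H : morphism Z Y} {D : displayed Y} {A B : ob Z}
    (f : tot_hom H D A B) : tot_hom H D B A :=
  existT _ (rev (projT1 f)) (act D (mphiv H (projT1 f)) (drev D (projT2 f))).

Lemma over_vcomp {Z Y : bigroupoid} {H : morphism Z Y} {D : displayed Y} {A B : ob Z}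
    (f g h : tot_hom H D A B) (x : cell (projT1 g) (projT1 h)) (y : cell (projT1 f) (projT1 g)) :
  over g h x -> over f g y -> over f h (x @ y).
Proof. by rewrite /over mcell_vcomp act_comp => <- <-. Qed.

Lemma over_id2 {Z Y : bigroupoid} {H : morphism Z Y} {D : displayed Y} {A B : ob Z}
    (f : tot_hom H D A B) : over f f (id2 (projT1 f)).
Proof. by rewrite /over mcell_id2 act_id. Qed.

Lemma over_inv2 {Z Y : bigroupoid} {H : morphism Z Y} {D : displayed Y} {A B : ob Z}
    (f g : tot_hom H D A B) (x : cell (projT1 f) (projT1 g)) :
  over f g x -> over g f (inv2 x).
Proof. by rewrite /over => <-; rewrite -act_comp -mcell_vcomp inv2l mcell_id2 act_id. Qed.

Lemma over_hcomp2 {Z Y : bigroupoid} {H : morphism Z Y} {D : displayed Y} {A B C : ob Z}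
    (g g' : tot_hom H D B C) (f f' : tot_hom H D A B)
    (y : cell (projT1 g) (projT1 g')) (x : cell (projT1 f) (projT1 f')) :
  over g g' y -> over f f' x -> over (tot_comp g f) (tot_comp g' f') (y ## x).
Proof.
case: (mdat_ok _ _ H) => [_ [_ [H2 _]]].
by rewrite /over /= => <- <-; rewrite dcomp_nat -!act_comp H2.
Qed.

Lemma over_rev2 {Z Y : bigroupoid} {H : morphism Z Y} {D : displayed Y} {A B : ob Z}
    (f g : tot_hom H D A B) (x : cell (projT1 f) (projT1 g)) :
  over f g x -> over (tot_rev f) (tot_rev g) (rev2 x).
Proof.
case: (mdat_ok _ _ H) => [_ [_ [_ [Hr _]]]].
by rewrite /over /= => <-; rewrite drev_nat -!act_comp Hr.
Qed.

Lemma dcomp_actl {Y : bigroupoid} (D : displayed Y) {A B C : ob Y} {g g' : hom B C}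
    {f : hom A B} (b : cell g g') (y : fam D g) (x : fam D f) :
  dcomp D (act D b y) x = act D (b ## id2 f) (dcomp D y x).
Proof. by rewrite -dcomp_nat act_id. Qed.

Lemma dcomp_actr {Y : bigroupoid} (D : displayed Y) {A B C : ob Y} {g : hom B C}
    {f f' : hom A B} (a : cell f f') (y : fam D g) (x : fam D f) :
  dcomp D y (act D a x) = act D (id2 g ## a) (dcomp D y x).
Proof. by rewrite -dcomp_nat act_id. Qed.

(** The associativity axiom for [H] reduces the claim to [dassoc]. The unit and inverse laws below
    follow the same pattern, each with its own axiom for [H]. *)
Lemma over_assoc {Z Y : bigroupoid} {H : morphism Z Y} {D : displayed Y} {A B C E : ob Z}
    (h : tot_hom H D C E) (g : tot_hom H D B C) (f : tot_hom H D A B) :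
  over (tot_comp (tot_comp h g) f) (tot_comp h (tot_comp g f))
    (assoc (projT1 h) (projT1 g) (projT1 f)).
Proof.
case: (mdat_ok _ _ H) => [_ [_ [_ [_ [Ha _]]]]].
by rewrite /over /= dcomp_actl dcomp_actr -dassoc -!act_comp -!vcompA Ha.
Qed.

Lemma over_lunit {Z Y : bigroupoid} {H : morphism Z Y} {D : displayed Y} {A B : ob Z}
    (f : tot_hom H D A B) : over (tot_comp (tot_id B) f) f (lunit (projT1 f)).
Proof.
case: (mdat_ok _ _ H) => [_ [_ [_ [_ [_ [_ [Hl _]]]]]]].
by rewrite /over /= dcomp_actl -!act_comp -!vcompA Hl dlunit.
Qed.

Lemma over_runit {Z Y : bigroupoid} {H : morphism Z Y} {D : displayed Y} {A B : ob Z}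
    (f : tot_hom H D A B) : over (tot_comp f (tot_id A)) f (runit (projT1 f)).
Proof.
case: (mdat_ok _ _ H) => [_ [_ [_ [_ [_ [Hr _]]]]]].
by rewrite /over /= dcomp_actr -!act_comp -!vcompA Hr drunit.
Qed.

Lemma over_ev {Z Y : bigroupoid} {H : morphism Z Y} {D : displayed Y} {A B : ob Z}
    (f : tot_hom H D A B) : over (tot_comp (tot_rev f) f) (tot_id A) (ev (projT1 f)).
Proof.
case: (mdat_ok _ _ H) => [_ [_ [_ [_ [_ [_ [_ [He _]]]]]]]].
by rewrite /over /= dcomp_actl -!act_comp -!vcompA He act_comp dev.
Qed.

Lemma over_coev {Z Y : bigroupoid} {H : morphism Z Y} {D : displayed Y} {A B : ob Z}
    (f : tot_hom H D A B) : over (tot_id B) (tot_comp f (tot_rev f)) (coev (projT1 f)).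
Proof.
case: (mdat_ok _ _ H) => [_ [_ [_ [_ [_ [_ [_ [_ Hc]]]]]]]].
by rewrite /over /= dcomp_actr -!act_comp Hc !act_comp (dcoev _ (projT2 f)).
Qed.

(* The pullback along [H] of the total bigroupoid of [D]. *)
Definition total {Z Y : bigroupoid} (H : morphism Z Y) (D : displayed Y) : bigroupoid.
Proof.
refine (Bigroupoid (ob Z) (tot_hom H D) (@tot_cell _ _ H D)
  (fun A B f g h x y => exist _ (proj1_sig x @ proj1_sig y)
     (over_vcomp _ _ _ _ _ (proj2_sig x) (proj2_sig y)))
  (fun A B f => exist _ (id2 (projT1 f)) (over_id2 f))
  (fun A B f g x => exist _ (inv2 (proj1_sig x)) (over_inv2 _ _ _ (proj2_sig x)))
  _ _ _ _ _
  (@tot_comp _ _ H D)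
  (fun A B C g g' f f' y x => exist _ (proj1_sig y ## proj1_sig x)
     (over_hcomp2 _ _ _ _ _ _ (proj2_sig y) (proj2_sig x))) _ _
  tot_id (@tot_rev _ _ H D)
  (fun A B f g x => exist _ (rev2 (proj1_sig x)) (over_rev2 _ _ _ (proj2_sig x))) _ _
  (fun A B C E h g f => exist _ _ (over_assoc h g f)) _
  (fun A B f => exist _ _ (over_lunit f)) _
  (fun A B f => exist _ _ (over_runit f)) _
  (fun A B f => exist _ _ (over_ev f)) _
  (fun A B f => exist _ _ (over_coev f)) _ _ _ _); intros; apply: sig_eq.
- exact: vcompA.
- exact: vcomp1l.
- exact: vcomp1r.
- exact: inv2l.
- exact: inv2r.
- exact: hcomp2_id.
- exact: hcomp2_comp.
- exact: rev2_id.
- exact: rev2_comp.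
- exact: assoc_nat.
- exact: lunit_nat.
- exact: runit_nat.
- exact: ev_nat.
- exact: coev_nat.
- exact: pentagon.
- exact: triangle.
- exact: ev_coev.
Defined.

Definition total_proj_data {Z Y : bigroupoid} (H : morphism Z Y) (D : displayed Y) :
    mdata (total H D) Z :=
  MData (total H D) Z (fun A => A) (fun A B f => projT1 f)
    (fun A B f g a => proj1_sig a) (fun A B C g f => id2 (projT1 g ** projT1 f))
    (fun A => @id2 Z _ _ (@id1 Z A)) (fun A B f => id2 (rev (projT1 f))).

Lemma total_proj_ok {Z Y : bigroupoid} (H : morphism Z Y) (D : displayed Y) :
  is_morphism (total_proj_data H D).
Proof. by do 8?[split] => * //=; rewrite !(hcomp2_id, vcomp1r, vcomp1l). Qed.

Definition total_proj {Z Y : bigroupoid} (H : morphism Z Y) (D : displayed Y) :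
    morphism (total H D) Z :=
  Morphism _ _ (total_proj_data H D) (total_proj_ok H D).

Lemma total_proj_strict {Z Y : bigroupoid} (H : morphism Z Y) (D : displayed Y) :
  is_strict (total_proj H D).
Proof. by do 2?[split] => *; exists eq_refl. Qed.

(** The source has the form of a composite, unit or inverse in [total (mor_id Y) D], because the
    structure 2-cells of [mor_id Y] are identities. *)
Lemma over_mor_id {Y : bigroupoid} (D : displayed Y) {A B : ob Y} (f g : hom A B)
    (x : fam D f) (a : cell f g) :
  @over Y Y (mor_id Y) D A B (existT _ f (act D (id2 f) x)) (existT _ g (act D a x)) a.
Proof. by rewrite /over /= act_id. Qed.

(** The structure 2-cells are those of [H], so this need not be strict; the universal property of a
    free morphism allows such a target. *)
Definition total_map_data {Z Y : bigroupoid} (H : morphism Z Y) (D : displayed Y) :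
    mdata (total H D) (total (mor_id Y) D) :=
  MData (total H D) (total (mor_id Y) D) (mob H)
    (fun A B f => existT _ (mhom H (projT1 f)) (projT2 f))
    (fun A B f g a => exist _ (mcell H (proj1_sig a)) (proj2_sig a))
    (fun A B C g f => exist _ (mphi2 H (projT1 g) (projT1 f))
       (over_mor_id D _ _ (dcomp D (projT2 g) (projT2 f)) _))
    (fun A => exist _ (mphi0 H A) (over_mor_id D _ _ (did1 D (mob H A)) _))
    (fun A B f => exist _ (mphiv H (projT1 f)) (over_mor_id D _ _ (drev D (projT2 f)) _)).

Lemma total_map_ok {Z Y : bigroupoid} (H : morphism Z Y) (D : displayed Y) :
  is_morphism (total_map_data H D).
Proof.
case: (mdat_ok _ _ H) => [H1 [Hc [H2 [Hr [Ha [Hru [Hlu [He Hco]]]]]]]].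
split; [|split; [|split; [|split; [|split; [|split; [|split; [|split]]]]]]];
  intros; apply: sig_eq.
- exact: H1.
- exact: Hc.
- exact: H2.
- exact: Hr.
- exact: Ha.
- exact: Hru.
- exact: Hlu.
- exact: He.
- exact: Hco.
Qed.

Definition total_map {Z Y : bigroupoid} (H : morphism Z Y) (D : displayed Y) :
    morphism (total H D) (total (mor_id Y) D) :=
  Morphism _ _ (total_map_data H D) (total_map_ok H D).

Lemma total_square {Z Y : bigroupoid} (H : morphism Z Y) (D : displayed Y) :
  mcomp (total_proj (mor_id Y) D) (total_map H D) = mcomp H (total_proj H D).
Proof.
apply: mdata_eq.
- move=> A1 A2 A3 g f.
  rewrite -[RHS]/(mcell H (id2 _) @ mphi2 H (projT1 g) (projT1 f)) mcell_id2 vcomp1l.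
  exact: vcomp1r.
- move=> A.
  rewrite -[RHS]/(mcell H (id2 _) @ mphi0 H A) mcell_id2 vcomp1l.
  exact: vcomp1r.
- move=> A A' f.
  rewrite -[RHS]/(mcell H (id2 _) @ mphiv H (projT1 f)) mcell_id2 vcomp1l.
  exact: vcomp1r.
Qed.

(** * Liftings of 1-cells along representatives *)

(* [f] sends the isomorphism class represented by [u] to the one represented by [v]. *)
Definition acts {Y : bigroupoid} {C A B : ob Y} (f : hom A B) (u : hom C A) (v : hom C B) : Prop :=
  nf u = u /\ nf v = v /\ iso1 (f ** u) v.

Definition lifting {Y : bigroupoid} (C : ob Y) {A B : ob Y} (f : hom A B) : Type :=
  forall (u : hom C A) (v : hom C B), acts f u v -> cell (f ** u) v.

Lemma acts_iso {Y : bigroupoid} {C A B : ob Y} (f g : hom A B) (u : hom C A) (v : hom C B) :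
  cell f g -> acts g u v -> acts f u v.
Proof.
move=> a [ru [rv i]]; split=> //; split=> //.
exact: iso1_trans (iso1_hcomp _ _ _ _ (inhabits a) (iso1_refl u)) i.
Qed.

Lemma acts_nf {Y : bigroupoid} {C A B D : ob Y} (g : hom B D) (f : hom A B) (u : hom C A)
    (w : hom C D) :
  acts (g ** f) u w -> acts f u (nf (f ** u)) /\ acts g (nf (f ** u)) w.
Proof.
move=> [ru [rw [i]]]; split; split; rewrite ?nf_nf //; split; rewrite ?nf_nf //.
  exact: nf_iso.
apply: iso1_trans (iso1_hcomp _ _ _ _ (iso1_refl g) (iso_nf _)) _.
by split; apply: (i @ inv2 (assoc g f u)).
Qed.

Lemma acts_unique {Y : bigroupoid} {C A B : ob Y} (f : hom A B) (u : hom C A) (v v' : hom C B) :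
  acts f u v -> acts f u v' -> v = v'.
Proof.
move=> [_ [rv i]] [_ [rv' i']]; rewrite -rv -rv'; apply: nf_eq.
exact: iso1_trans (iso1_sym _ _ i) i'.
Qed.

Lemma acts_id {Y : bigroupoid} {C A : ob Y} (u v : hom C A) : acts (id1 A) u v -> u = v.
Proof.
move=> [ru [rv [i]]]; rewrite -ru -rv; apply: nf_eq; split; exact: (i @ inv2 (lunit u)).
Qed.

Lemma acts_id_refl {Y : bigroupoid} {C A : ob Y} (u : hom C A) : nf u = u -> acts (id1 A) u u.
Proof. by move=> ru; split=> //; split=> //; split; apply: lunit. Qed.

Lemma acts_rev {Y : bigroupoid} {C A B : ob Y} (f : hom A B) (u : hom C B) (v : hom C A) :
  acts (rev f) u v -> acts f v u.
Proof.
move=> [ru [rv i]]; split=> //; split=> //.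
apply: iso1_trans (iso1_hcomp _ _ _ _ (iso1_refl f) (iso1_sym _ _ i)) _; split.
exact: (lunit u @ (inv2 (coev f) ## id2 u) @ inv2 (assoc f (rev f) u)).
Qed.

Lemma lifting_eq {Y : bigroupoid} {C A B : ob Y} {f : hom A B} (x y : lifting C f) :
  (forall u v (r : acts f u v), x u v r = y u v r) -> x = y.
Proof. by move=> e; do 3!(apply: functional_extensionality_dep => ?); apply: e. Qed.

Definition lift_act {Y : bigroupoid} (C : ob Y) {A B : ob Y} {f g : hom A B} (a : cell f g)
    (x : lifting C f) : lifting C g :=
  fun u v r => x u v (acts_iso f g u v a r) @ (inv2 a ## id2 u).

Definition lift_comp {Y : bigroupoid} (C : ob Y) {A B D : ob Y} {g : hom B D} {f : hom A B}
    (y : lifting C g) (x : lifting C f) : lifting C (g ** f) :=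
  fun u w r => y (nf (f ** u)) w (proj2 (acts_nf g f u w r)) @
    ((id2 g ## x u (nf (f ** u)) (proj1 (acts_nf g f u w r))) @ assoc g f u).

Definition lift_id {Y : bigroupoid} (C A : ob Y) : lifting C (id1 A) :=
  fun u v r => cell_of_eq (acts_id u v r) @ lunit u.

(** The inverse of the chosen 2-cell [f ** v => u] is whiskered with [rev f], after which [ev f]
    cancels [rev f] against [f]. *)
Definition lift_rev {Y : bigroupoid} (C : ob Y) {A B : ob Y} {f : hom A B}
    (x : lifting C f) : lifting C (rev f) :=
  fun u v r => lunit v @ ((ev f ## id2 v) @
    (inv2 (assoc (rev f) f v) @ (id2 (rev f) ## inv2 (x v u (acts_rev f u v r))))).

(** By [acts_unique] the midpoint [v] is forced to be [nf (f ** u)]; later computations may thus use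
    any convenient midpoint and any proofs of [acts]. *)
Lemma lift_compE {Y : bigroupoid} {C A B D : ob Y} {g : hom B D} {f : hom A B}
    (y : lifting C g) (x : lifting C f) u v w (r : acts (g ** f) u w) (rx : acts f u v)
    (ry : acts g v w) :
  lift_comp C y x u w r = y v w ry @ ((id2 g ## x u v rx) @ assoc g f u).
Proof.
rewrite /lift_comp; move: (proj1 _) (proj2 _) => r1 r2.
have e := acts_unique _ _ _ _ rx r1; subst v.
by rewrite (proof_irrelevance _ rx r1) (proof_irrelevance _ ry r2).
Qed.

Lemma lift_idE {Y : bigroupoid} {C A : ob Y} (u : hom C A) (r : acts (id1 A) u u) :
  lift_id C A u u r = lunit u.
Proof. by rewrite /lift_id (proof_irrelevance _ (acts_id u u r) eq_refl) /= vcomp1l. Qed.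

(** Moving [a] to the other side removes the inverse from [lift_act]; the laws of the displayed
    bigroupoid are all proved in this form. *)
Lemma lift_actE {Y : bigroupoid} {C A B : ob Y} {f g : hom A B} (a : cell f g)
    (x : lifting C f) (y : lifting C g) :
  (forall u v (r : acts f u v) (r' : acts g u v), x u v r = y u v r' @ (a ## id2 u)) ->
  lift_act C a x = y.
Proof.
move=> e; apply: lifting_eq => u v r.
rewrite /lift_act (e _ _ _ r) -vcompA -hcomp2_wr inv2r hcomp2_id; exact: vcomp1r.
Qed.

Lemma lift_act_apply {Y : bigroupoid} {C A B : ob Y} {f g : hom A B} (a : cell f g)
    (x : lifting C f) u v (r : acts f u v) (r' : acts g u v) :
  x u v r = lift_act C a x u v r' @ (a ## id2 u).
Proof.
rewrite /lift_act -vcompA -hcomp2_wr inv2l hcomp2_id vcomp1r.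
by rewrite (proof_irrelevance _ r (acts_iso f g u v a r')).
Qed.

Lemma acts_comp {Y : bigroupoid} {C A B D : ob Y} (g : hom B D) (f : hom A B) (u : hom C A)
    (v : hom C B) (w : hom C D) :
  acts f u v -> acts g v w -> acts (g ** f) u w.
Proof.
move=> [ru [_ i]] [_ [rw j]]; split=> //; split=> //.
apply: (iso1_trans _ (g ** f ** u)); first by split; apply: assoc.
exact: iso1_trans (iso1_hcomp _ _ _ _ (iso1_refl g) i) j.
Qed.

Lemma lift_comp_nat {Y : bigroupoid} {C A B D : ob Y} {g g' : hom B D} {f f' : hom A B}
    (b : cell g g') (a : cell f f') (y : lifting C g) (x : lifting C f) :
  lift_comp C (lift_act C b y) (lift_act C a x) = lift_act C (b ## a) (lift_comp C y x).
Proof.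
symmetry; apply: lift_actE => u w r r'.
case: (acts_nf g' f' u w r') => r1' r2'.
have r1 := acts_iso _ _ _ _ a r1'; have r2 := acts_iso _ _ _ _ b r2'.
rewrite (lift_compE _ _ _ _ _ _ r1 r2) (lift_compE _ _ _ _ _ _ r1' r2').
rewrite -!vcompA assoc_nat (vcomp_assoc (id2 g' ## _)) -hcomp2_comp vcomp1l.
rewrite -(lift_act_apply a x u _ r1 r1') -hcomp2_lr (lift_act_apply b y _ w r2 r2').
rewrite -!vcompA (vcomp_assoc (b ## id2 _)) hcomp2_lr.
by rewrite -[in RHS](hcomp2_lr b) -!vcompA.
Qed.

Lemma inv2_assoc_nat {X : bigroupoid} {A B C D : ob X} {h h' : hom C D} {g g' : hom B C}
    {f f' : hom A B} (c : cell h h') (b : cell g g') (a : cell f f') :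
  inv2 (assoc h' g' f') @ (c ## (b ## a)) = ((c ## b) ## a) @ inv2 (assoc h g f).
Proof.
apply: (vcompKl (assoc h' g' f')); rewrite !vcompA inv2r vcomp1l assoc_nat -vcompA inv2r.
by rewrite vcomp1r.
Qed.

Lemma lift_rev_nat {Y : bigroupoid} {C A B : ob Y} {f g : hom A B} (a : cell f g)
    (x : lifting C f) :
  lift_rev C (lift_act C a x) = lift_act C (rev2 a) (lift_rev C x).
Proof.
symmetry; apply: lift_actE => u v r r'; rewrite /lift_rev -!vcompA; congr (_ @ _).
rewrite (lift_act_apply a x v u (acts_rev f u v r) (acts_rev g u v r')).
rewrite inv2_comp hcomp2_rl -(hcomp2_lr (rev2 a)) hcomp2_wl !vcompA; congr (_ @ _).
apply: (vcompKr (id2 (rev f) ## (a ## id2 v))).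
rewrite -!vcompA -hcomp2_wl inv2l hcomp2_id vcomp1r hcomp2_lr inv2_assoc_nat.
by rewrite vcompA -hcomp2_wr ev_nat vcomp1l.
Qed.

(** Once the midpoints are matched, the pentagon and naturality of [assoc] remain. *)
Lemma lift_assoc {Y : bigroupoid} {C A B D E : ob Y} {h : hom D E} {g : hom B D} {f : hom A B}
    (z : lifting C h) (y : lifting C g) (x : lifting C f) :
  lift_act C (assoc h g f) (lift_comp C (lift_comp C z y) x)
  = lift_comp C z (lift_comp C y x).
Proof.
apply: lift_actE => u w r r'.
case: (acts_nf _ _ _ _ r') => r1 r2; case: (acts_nf _ _ _ _ r1) => r3 r4.
have r5 := acts_comp _ _ _ _ _ r4 r2.
rewrite (lift_compE _ _ _ _ _ _ r3 r5) (lift_compE _ _ _ _ _ _ r4 r2).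
rewrite (lift_compE _ _ _ _ _ _ r1 r2) (lift_compE _ _ _ _ _ _ r3 r4).
rewrite !hcomp2_wl -!vcompA -pentagon (vcomp_assoc (assoc h g _) (_ ## _)) -hcomp2_id assoc_nat.
by rewrite -!vcompA.
Qed.

Lemma lift_lunit {Y : bigroupoid} {C A B : ob Y} {f : hom A B} (x : lifting C f) :
  lift_act C (lunit f) (lift_comp C (lift_id C B) x) = x.
Proof.
apply: lift_actE => u v r r'.
have [ru [rv i]] := r'.
rewrite (lift_compE _ _ _ _ _ _ r' (acts_id_refl v rv)) lift_idE vcompA lunit_nat -vcompA.
by rewrite lunit_hcomp.
Qed.

Lemma lift_runit {Y : bigroupoid} {C A B : ob Y} {f : hom A B} (x : lifting C f) :
  lift_act C (runit f) (lift_comp C x (lift_id C A)) = x.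
Proof.
apply: lift_actE => u v r r'.
have [ru [rv i]] := r'.
by rewrite (lift_compE _ _ _ _ _ _ (acts_id_refl u ru) r') lift_idE triangle.
Qed.

Lemma lift_ev {Y : bigroupoid} {C A B : ob Y} {f : hom A B} (x : lifting C f) :
  lift_act C (ev f) (lift_comp C (lift_rev C x) x) = lift_id C A.
Proof.
apply: lift_actE => u v r r'.
have e := acts_id _ _ r'; subst v.
case: (acts_nf _ _ _ _ r) => r1 r2.
rewrite (lift_compE _ _ _ _ _ _ r1 r2) lift_idE /lift_rev.
rewrite (proof_irrelevance _ (acts_rev f _ u r2) r1) -!vcompA; congr (_ @ _).
by rewrite (vcomp_assoc (id2 _ ## inv2 _)) -hcomp2_wl inv2l hcomp2_id vcomp1l inv2l vcomp1r.
Qed.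

(** Naturality moves the inverse of the chosen 2-cell to the right of [coev f]; [zigzag_hcomp]
    collapses what precedes it to a left unit, and the chosen 2-cell then cancels against its
    inverse. *)
Lemma lift_coev {Y : bigroupoid} {C A B : ob Y} {f : hom A B} (x : lifting C f) :
  lift_act C (coev f) (lift_id C B) = lift_comp C x (lift_rev C x).
Proof.
apply: lift_actE => u v r r'.
have e := acts_id _ _ r; subst v.
case: (acts_nf _ _ _ _ r') => r1 r2.
rewrite (lift_compE _ _ _ _ _ _ r1 r2) lift_idE /lift_rev.
rewrite (proof_irrelevance _ (acts_rev f _ _ r1) r2) !hcomp2_wl -!vcompA.
rewrite (vcomp_assoc (id2 f ## (id2 (rev f) ## _))) -assoc_nat hcomp2_id -!vcompA.
rewrite hcomp2_rl -(hcomp2_lr (coev f)).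
rewrite (vcomp_assoc (assoc f _ _)) (vcomp_assoc (id2 f ## inv2 _)).
rewrite (vcomp_assoc (id2 f ## (_ ## _))).
rewrite (vcomp_assoc (id2 f ## lunit _)) zigzag_hcomp lunit_nat.
by rewrite vcompA inv2r vcomp1l.
Qed.

Definition liftings {Y : bigroupoid} (C : ob Y) : displayed Y.
Proof.
refine (Displayed Y (@lifting Y C) (@lift_act Y C) (@lift_comp Y C) (lift_id C)
  (@lift_rev Y C) _ _ (@lift_comp_nat Y C) (@lift_rev_nat Y C) (@lift_assoc Y C)
  (@lift_lunit Y C) (@lift_runit Y C) (@lift_ev Y C) (@lift_coev Y C)).
- move=> A B f x; apply: lift_actE => u v r r'.
  by rewrite hcomp2_id vcomp1r (proof_irrelevance _ r r').
- move=> A B f g h b a x; apply: lift_actE => u v r r'; rewrite hcomp2_wr vcompA.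
  have rg := acts_iso _ _ _ _ b r'.
  by rewrite -(lift_act_apply b _ _ _ rg) -lift_act_apply.
Defined.

(** Since [acts] asserts only that a 2-cell exists, [epsilon] with the trivial predicate picks
    one. *)
Definition some_lifting {Y : bigroupoid} (C : ob Y) {A B : ob Y} (f : hom A B) : lifting C f :=
  fun u v r => epsilon (proj2 (proj2 r)) (fun _ => True).

(** * Coherence for the free morphism *)

(* Arbitrary liftings of the generators extend to a section of the bigroupoid of liftings; a 2-cell
   [a : f => g], whiskered with a representative [u], is then determined by the liftings chosen for
   [f] and [g]. *)
Lemma free_morphism_coherence {G G' : graph} {F : gmorph G G'}
    {X : bigroupoid} {Ib : gmorph G (bgraph X)}
    {Y : bigroupoid} {M : morphism X Y} {Im : gmorph G' (bgraph Y)} :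
  is_free_morphism F X Ib Y M Im ->
  forall (A B : ob Y) (f g : hom A B) (a b : cell f g), a = b.
Proof.
move=> [MI uM].
have whisker (C A B : ob Y) (f g : hom A B) (a b : cell f g) (u : hom C A) :
    nf u = u -> a ## id2 u = b ## id2 u.
  pose D := liftings C.
  (* These are mere graph morphisms. Over [X] the choice is made for [mhom M f], so that the square
     [sq] commutes. *)
  pose sX := GMorph (bgraph X) (bgraph (total M D)) (fun A => A)
    (fun A B f => existT _ f (some_lifting C (mhom M f))).
  pose sY := GMorph (bgraph Y) (bgraph (total (mor_id Y) D)) (fun A => A)
    (fun A B f => existT _ f (some_lifting C f)).
  have sq : gcomp (mgraph (total_map M D)) (gcomp sX Ib) = gcomp (gcomp sY Im) F.
    by rewrite -[LHS]/(gcomp sY (gcomp (mgraph M) Ib)) MI.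
  case: (uM _ _ (total_map M D) (gcomp sX Ib) (gcomp sY Im) sq).
  move=> [Rt [St [sRt [sSt [RtI [StI e]]]]]] _.
  (* Uniqueness is used for the square of [M] itself: the projections of [Rt] and [St], like the
     identities, extend [Ib] and [Im]. *)
  have split : mcomp (total_proj (mor_id Y) D) St = mid Y.
  { apply: (proj2 (proj2 (uM _ _ M Ib Im MI) (mor_comp (total_proj M D) Rt) (mor_id X)
      (mor_comp (total_proj (mor_id Y) D) St) (mor_id Y) _ _ _ _ _ _ _ _ _ _)).
    - by apply: mcomp_strict => //; apply: total_proj_strict.
    - by apply: mcomp_strict => //; apply: total_proj_strict.
    - rewrite -[LHS]/(gcomp (mgraph (total_proj M D)) (gcomp (mgraph Rt) Ib)) RtI.
      exact: gmorph_eta.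
    - rewrite -[LHS]/(gcomp (mgraph (total_proj (mor_id Y) D)) (gcomp (mgraph St) Im)) StI.
      exact: gmorph_eta.
    - by rewrite /= mcompA -total_square -mcompA e mcompA.
    - exact: mid_strict.
    - exact: mid_strict.
    - exact: gmorph_eta.
    - exact: gmorph_eta.
    - by rewrite /= mcomp1r mcomp1l. }
  have : forall (A B : ob Y) (f g : hom A B) (a b : cell f g)
      (u : hom C (mob (mcomp (total_proj (mor_id Y) D) St) A)), nf u = u ->
      mcell (mcomp (total_proj (mor_id Y) D) St) a ## id2 u
      = mcell (mcomp (total_proj (mor_id Y) D) St) b ## id2 u.
    clear; move=> A B f g a b u ru /=.
    set x := mcell St a; set y := mcell St b.
    have rg : acts (projT1 (mhom St g)) u (nf (projT1 (mhom St g) ** u)).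
      by split=> //; split; [apply: nf_nf | apply: nf_iso].
    have rf := acts_iso _ _ _ _ (proj1_sig x) rg.
    (* Composed with the lifting of [g], both sides become the lifting of [f], because [x] and [y]
       carry the latter to the former. *)
    apply: (vcompKl (projT2 (mhom St g) _ _ rg)).
    rewrite -{1}(proj2_sig x) -{1}(proj2_sig y).
    by rewrite -!(lift_act_apply _ _ _ _ rf rg).
  by rewrite split => H; apply: H.
(* Any representative ending at [A] would do; that of [id1 A] always exists. *)
move=> A B f g a b; apply: (hcomp2_whisker_inj (nf (id1 A))); apply: whisker; exact: nf_nf.
Qed.

Theorem theoremC3
  (G G' : graph) (F : gmorph G G')
  (FbG : bigroupoid) (Ib : gmorph G (bgraph FbG))
  (Hb : is_free_bigroupoid G FbG Ib)
  (FsG : bigroupoid) (Is : gmorph G (bgraph FsG))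
  (Hs : is_free_2groupoid G FsG Is)
  (FsG' : bigroupoid) (Is' : gmorph G' (bgraph FsG'))
  (Hs' : is_free_2groupoid G' FsG' Is')
  (FmG' : bigroupoid) (FmF : morphism FbG FmG') (Im : gmorph G' (bgraph FmG'))
  (Hm : is_free_morphism F FbG Ib FmG' FmF Im)
  (Gam : morphism FbG FsG) (HGam_s : is_strict Gam)
  (HGam : gcomp (mgraph Gam) Ib = Is)
  (FsF : morphism FsG FsG') (HFsF_s : is_strict FsF)
  (HFsF : gcomp (mgraph FsF) Is = gcomp Is' F)
  (Del : morphism FmG' FsG') (HDel_s : is_strict Del)
  (HDel1 : gcomp (mgraph Del) Im = Is')
  (HDel2 : mcomp Del FmF = mcomp FsF Gam) :
  is_biequivalence Del /\ locally_faithful Del.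
Proof.
have coh := free_morphism_coherence Hm.
have dS := free_2groupoid_locally_discrete _ _ _ Hs'.
have full := free_2groupoid_full Is' Im Del Hs' HDel1.
have [K [KI _]] := free_2groupoid_section Is' Im Del Hs' dS HDel1.
have KDel := free_morphism_quotient Hb Hm HGam_s HGam HFsF HDel1 HDel2 K KI.
(* Injectivity is read off [KDel]: the quotient map is the identity on 0-cells and identifies only
   isomorphic 1-cells. *)
have inj_ob : forall A A' : ob FmG', mob Del A = mob Del A' -> A = A'.
  have : forall A A' : ob FmG', mob Del A = mob Del A' ->
      mob (mcomp K Del) A = mob (mcomp K Del) A' by move=> A A' /= ->.
  by rewrite KDel.
have inj_hom : forall (A A' : ob FmG') (f f' : hom A A'), mhom Del f = mhom Del f' -> iso1 f f'.
  have : forall (A A' : ob FmG') (f f' : hom A A'), mhom Del f = mhom Del f' ->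
      mhom (mcomp K Del) f = mhom (mcomp K Del) f' by move=> A A' f f' /= ->.
  by rewrite KDel => H A A' f f' /H /cls_iso.
(* The preimage from [full] may have other end points; [inj_ob] identifies them with [A] and [A'],
   and proof irrelevance removes the transport. *)
have onto (A A' : ob FmG') (g : hom (mob Del A) (mob Del A')) :
    exists f : hom A A', mhom Del f = g.
  case: (full _ _ g) => B [B' [f [e [e' <-]]]].
  have eB := inj_ob _ _ e; have eB' := inj_ob _ _ e'; subst B B'.
  by exists f; rewrite (proof_irrelevance _ e eq_refl) (proof_irrelevance _ e' eq_refl).
split; last by move=> A A' f g a b _; apply: coh.
split.
  move=> B; case: (full _ _ (id1 B)) => A [_ [_ [e _]]].
  by exists A; rewrite e; split; apply: id1.
move=> A A'.
(* The pseudo-inverse chooses strict preimages of 1-cells. Its action on 2-cells comes from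
   [inj_hom], and its laws hold because parallel 2-cells coincide on both sides. *)
pose L g := proj1_sig (constructive_indefinite_description _ (onto A A' g)).
have LK g : mhom Del (L g) = g by rewrite /L; case: constructive_indefinite_description.
have lift f f' (e : mhom Del f = mhom Del f') : cell (f : hom A A') f'.
  exact: epsilon (inj_hom _ _ _ _ e) (fun _ => True).
exists L, (fun g g' a => lift _ _ (eq_trans (LK g) (eq_trans (eqcell_eq _ (dS _ _ _ _ a))
  (eq_sym (LK g'))))), (fun f => lift _ _ (eq_sym (LK (mhom Del f)))), (fun g => cell_of_eq (LK g)).
by split; [|split; [|split]] => *; (apply: coh || apply: locally_discrete_unique).
Qed.
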